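(* Let $\mathcal{C}$ be a clutter with vertex set $X=\{x_1,\dots,x_n\}$ that has the free vertex property. Then the simplicial complex $\Delta_{\mathcal{C}}$ is shellable.
   Context: A clutter $\mathcal{C}$ with vertex set $X=\{x_1,\dots,x_n\}$ is a family of subsets of $X$ (edges), none contained in another. Its edge ideal is $I(\mathcal{C})\subset R=k[x_1,\dots,x_n]$ ($k$ a field), generated by the squarefree monomials $\prod_{x\in S}x$ for edges $S$; conversely, an ideal minimally generated by squarefree monomials $x^{v_1},\dots,x^{v_q}$ defines the clutter whose edges are the supports of the $x^{v_i}$. $\Delta_{\mathcal{C}}$ is the Stanley–Reisner complex of $I(\mathcal{C})$ on $X$; its facets are exactly the sets $X\setminus C$ with $C$ a minimal vertex cover of $\mathcal{C}$ (a vertex cover is a set meeting every edge). A simplicial complex is shellable if its facets can be ordered $F_1,\dots,F_s$ so that for all $1\le i<j\le s$ there exist $v\in F_j\setminus F_i$ and $\ell\in\{1,\dots,j-1\}$ with $F_j\setminus F_\ell=\{v\}$ (non-pure shellability). A minor of $I=I(\mathcal{C})$ is an ideal $I'$ of $R'=k[X\setminus X']$, for some subset $X'=\{x_{i_1},\dots,x_{i_r},x_{j_1},\dots,x_{j_s}\}\subset X$, obtained from the generators of $I$ by setting $x_{i_a}=0$ and $x_{j_b}=1$ for all $a,b$, provided $(0)\subsetneq I'\subsetneq R'$; $I$ itself is also a minor. A minor of $\mathcal{C}$ is the clutter on $X\setminus X'$ whose edges are the supports of the minimal squarefree monomial generators of such a minor $I'$. A vertex is free in a clutter if it lies in exactly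 one edge. $\mathcal{C}$ has the free vertex property if every minor of $\mathcal{C}$ (including $\mathcal{C}$) has a free vertex. *)

(* Defs.v *)
From HB Require Import structures.
From mathcomp Require Import all_boot all_order all_algebra.
From mathcomp Require Import mpoly.

Set Implicit Arguments.
Unset Strict Implicit.
Unset Printing Implicit Defensive.

Import GRing.Theory.
Local Open Scope ring_scope.

(* The variable x_i is identified with its index i : 'I_n.  The vertex set is
   part of the data, since vertices need not lie in any edge and a minor lives
   on a smaller vertex set. *)
Record clutter (n : nat) := Clutter {
  vertices : {set 'I_n};
  edges : {set {set 'I_n}};
  edges_sub : forall S, S \in edges -> S \subset vertices;
  edges_antichain :
    forall S T, S \in edges -> T \in edges -> S \subset T -> S = T
}.

Section Ideals.
Variables (k : fieldType) (n : nat).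
Implicit Types (V A B F S : {set 'I_n}) (E : {set {set 'I_n}}).
Implicit Types (p : {mpoly k[n]}) (I J : {mpoly k[n]} -> Prop).

(* The polynomial ring k[V] on the variables of V, as a subring of k[x_i, i < n]. *)
Definition in_subring V p : Prop :=
  forall m, m \in msupp p -> forall i, i \notin V -> m i = 0%N.

Definition xprod S : {mpoly k[n]} := \prod_(i in S) 'X_i.

(* The ideal of k[V] (not of the ambient ring) generated by the g S, S in E. *)
Definition ideal_gen V E (g : {set 'I_n} -> {mpoly k[n]}) p : Prop :=
  exists2 c : {set 'I_n} -> {mpoly k[n]},
    (forall S, S \in E -> in_subring V (c S)) & p = \sum_(S in E) c S * g S.

Definition edge_ideal (C : clutter n) : {mpoly k[n]} -> Prop :=
  ideal_gen (vertices C) (edges C) xprod.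

Definition eq_ideal I J : Prop := forall p, I p <-> J p.

(* (0) <> I <> k[V] *)
Definition proper_nonzero V I : Prop :=
  (exists2 p, I p & p <> 0) /\ (exists2 p, in_subring V p & ~ I p).

Definition subst01 A B p : {mpoly k[n]} :=
  p \mPo [tuple if i \in A then 0 else if i \in B then 1 else 'X_i | i < n].

(* Ideal of k[X \ (A U B)] obtained from the generators of I(C) by setting the
   variables of A to 0 and those of B to 1. *)
Definition minor_ideal (C : clutter n) A B : {mpoly k[n]} -> Prop :=
  ideal_gen (vertices C :\: (A :|: B)) (edges C)
            (fun S => subst01 A B (xprod S)).

(* The ideal I of k[V] is minimally generated by the x^S, S in E. *)
Definition min_generated V E I : Prop :=
  eq_ideal (ideal_gen V E xprod) I /\
  forall E', E' \proper E -> ~ eq_ideal (ideal_gen V E' xprod) I.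

Definition is_minor (C D : clutter n) : Prop :=
  D = C \/
  exists A B,
    [/\ A \subset vertices C, B \subset vertices C & [disjoint A & B]] /\
    [/\ proper_nonzero (vertices C :\: (A :|: B)) (minor_ideal C A B),
        vertices D = vertices C :\: (A :|: B)
      & min_generated (vertices D) (edges D) (minor_ideal C A B)].

Definition free_vertex (C : clutter n) (i : 'I_n) : Prop :=
  i \in vertices C /\ #|[set S in edges C | i \in S]| = 1%N.

Definition free_vertex_property (C : clutter n) : Prop :=
  forall D, is_minor C D -> exists i, free_vertex D i.

End Ideals.

(* The empty face is not required, so that the complex of the unit ideal is the
   void complex. *)
Record simplicial_complex (n : nat) := SimplicialComplex {
  face : {set 'I_n} -> Prop;
  face_sub : forall F G : {set 'I_n}, F \subset G -> face G -> face F
}.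

Definition facet n (K : simplicial_complex n) (F : {set 'I_n}) : Prop :=
  face K F /\ forall G : {set 'I_n}, face K G -> F \subset G -> G = F.

(* Non-pure shellability; positions in the shelling are numbered from 0. *)
Definition shellable n (K : simplicial_complex n) : Prop :=
  exists s : seq {set 'I_n},
    [/\ uniq s,
        forall F, F \in s <-> facet K F
      & forall i j, (i < j < size s)%N ->
          exists v l, [/\ v \in nth set0 s j :\: nth set0 s i, (l < j)%N
                        & nth set0 s j :\: nth set0 s l = [set v]]].

Section StanleyReisner.
Variables (k : fieldType) (n : nat) (C : clutter n).

Definition sr_face (F : {set 'I_n}) : Prop :=
  F \subset vertices C /\ ~ edge_ideal C (xprod k F).

Lemma in_subringM (V : {set 'I_n}) (p q : {mpoly k[n]}) :
  in_subring V p -> in_subring V q -> in_subring V (p * q).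
Proof.
move=> hp hq m /msuppM_le /allpairsP[[m1 m2] /= [h1 h2 ->]] i hi.
by rewrite mnmDE (hp _ h1) // (hq _ h2).
Qed.

Lemma in_subring_xprod (V S : {set 'I_n}) :
  S \subset V -> in_subring V (xprod k S).
Proof.
move=> /subsetP sSV; rewrite /xprod.
elim/big_ind: _ => [m|p q|j /sSV jV m]; first last.
- rewrite msuppX inE => /eqP-> i iV; rewrite mnm1E.
  by case: eqP jV iV => // -> ->.
- exact: in_subringM.
- by rewrite msupp1 inE => /eqP-> i _; rewrite mnm0E.
Qed.

Lemma sr_face_sub (F G : {set 'I_n}) : F \subset G -> sr_face G -> sr_face F.
Proof.
move=> sFG [sGV nG]; split; first exact: subset_trans sGV.
case=> c hc eF; apply: nG; exists (fun S => xprod k (G :\: F) * c S).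
  move=> S hS; apply: in_subringM (hc S hS).
  by apply: in_subring_xprod; apply: subset_trans sGV; apply: subsetDl.
under eq_bigr do rewrite -mulrA.
rewrite -mulr_sumr -eF /xprod (big_setID F) /= (setIidPr sFG); exact: mulrC.
Qed.

Definition stanley_reisner : simplicial_complex n :=
  SimplicialComplex sr_face_sub.

End StanleyReisner.

(* Main.v *)
(** A minor with [A] set to 0 and [B] set to 1 corresponds to the independent
    sets [G] with [B \subset G] and [G] disjoint from [A]; by induction on the
    number of remaining vertices, the maximal sets of every such family have a
    shelling order.  If [x] is a free vertex of the minor, lying in the edge [e]
    only, list first the maximal sets containing [x] (the minor with [x = 1]) and
    then those avoiding [x]; the latter contain [e :\ x], so they come from
    the minor with [x = 0] and [e :\ x] set to 1.  If [G] avoids [x] and [H]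
    contains [x], then some [y] in [e :\ x] is not in [H], and any maximal set
    containing [x |: (G :\ y)] precedes [G] and misses only [y] from [G]. *)

Require Import Defs.
From mathcomp Require Import all_boot all_order all_algebra.
From mathcomp Require Import mpoly.

Set Implicit Arguments.
Unset Strict Implicit.
Unset Printing Implicit Defensive.

Import GRing.Theory.

(** * Concatenation of shelling orders *)

Section Shellings.
Variable T : finType.
Implicit Types (V A B G H S : {set T}) (E : {set {set T}}) (s : seq {set T}).

Lemma disjoint0s A : [disjoint set0 & A].
Proof. by rewrite disjoints_subset sub0set. Qed.

Lemma disjointsU A B G :
  [disjoint A :|: B & G] = [disjoint A & G] && [disjoint B & G].
Proof. by rewrite !disjoints_subset subUset. Qed.

Lemma disjointsU1 x A G :
  [disjoint x |: A & G] = (x \notin G) && [disjoint A & G].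
Proof. by rewrite disjointsU disjoints1. Qed.

Definition shelling_order s : Prop :=
  forall i j, i < j < size s ->
    exists v l, [/\ v \in nth set0 s j :\: nth set0 s i, l < j
                  & nth set0 s j :\: nth set0 s l = [set v]].

(** Only a pair with [H] in [s1] and [G] in [s2] is new. Its witness [L] may sit anywhere in [s1],
    since all of [s1] precedes [G]. *)
Lemma shelling_order_cat s1 s2 :
    shelling_order s1 -> shelling_order s2 ->
    (forall H G, H \in s1 -> G \in s2 ->
       exists v L, [/\ v \in G :\: H, L \in s1 & G :\: L = [set v]]) ->
  shelling_order (s1 ++ s2).
Proof.
move=> sh1 sh2 sh12 i j; rewrite size_cat => /andP[ij js].
have [j1|j1] := ltnP j (size s1).
  have [|v [l [vij lj jl]]] := sh1 i j; first by rewrite ij j1.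
  exists v, l; rewrite !nth_cat j1 (ltn_trans ij j1) (ltn_trans lj j1).
  by split.
have js2 : j - size s1 < size s2 by rewrite ltn_subLR.
have [i1|i1] := ltnP i (size s1).
  have [v [L [vij Ls1 jL]]] := sh12 _ _ (mem_nth set0 i1) (mem_nth set0 js2).
  exists v, (index L s1); rewrite !nth_cat ltnNge j1 /= i1 index_mem Ls1.
  by rewrite nth_index //; split=> //; apply: leq_trans j1; rewrite index_mem.
have [|v [l [vij lj jl]]] := sh2 (i - size s1) (j - size s1).
  by rewrite js2 andbT ltn_sub2r // (leq_ltn_trans i1 ij).
exists v, (size s1 + l); rewrite !nth_cat !ltnNge j1 i1 leq_addr /= addKn.
by split; rewrite // -ltnNge -ltn_subRL.
Qed.

(** * Minors in combinatorial form *)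

Definition indep V E G := (G \subset V) && [forall S in E, ~~ (S \subset G)].

(** Faces of the minor with [B] added back to each. Set differences between faces are unchanged, and
    the facets of different minors can be listed together. *)
Definition minor_face V E A B G :=
  [&& B \subset G, [disjoint A & G] & indep V E G].

(** Supports of the generators that survive [A] set to 0 and [B] set to 1; they need not form an
    antichain. *)
Definition restricted_edges E A B :=
  [set S :\: B | S in [set S in E | [disjoint S & A]]].

Definition minor_edges E A B :=
  [set S | minset (mem (restricted_edges E A B)) S].

Lemma minor_edgesP E A B S :
  S \in minor_edges E A B ->
  exists S', [/\ S' \in E, [disjoint S' & A] & S = S' :\: B].
Proof.
rewrite inE => /minsetp /= /imsetP[S'].
by rewrite inE => /andP[S'E S'A] ->; exists S'.
Qed.

Lemma minor_edges_below E A B S :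
    S \in E -> [disjoint S & A] ->
  exists2 S', S' \in minor_edges E A B & S' \subset S :\: B.
Proof.
move=> SE SA.
have SR : mem (restricted_edges E A B) (S :\: B).
  by apply/imsetP; exists S; rewrite ?inE ?SE.
by have [S' mS' sS'] := minset_exists SR; exists S'; rewrite ?inE.
Qed.

Lemma minor_edges_antichain E A B S S' :
    S \in minor_edges E A B -> S' \in minor_edges E A B -> S \subset S' ->
  S = S'.
Proof.
rewrite !inE => /minsetp /= RS /minsetP[_ minS'] sSS'.
exact: minS'.
Qed.

(** An edge inside [G] avoids [A], so it contains a minimal restricted edge up to elements of [B].
    Conversely, as [B] lies in [G], a restricted edge inside [G] comes from an edge inside [G]. *)
Lemma minor_faceE V E A B G :
  minor_face V E A B G = [&& B \subset G, [disjoint A & G], G \subset V &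
                           [forall S in minor_edges E A B, ~~ (S \subset G)]].
Proof.
rewrite /minor_face /indep.
have [BG|//] := boolP (B \subset G); have [AG|//] := boolP [disjoint A & G].
congr [&& _, _, _ & _]; apply/forall_inP/forall_inP => noS S.
  move=> /minor_edgesP[S' [S'E _ ->]]; rewrite subDset (setUidPr BG).
  exact: noS.
move=> SE; apply/negP => SG.
have [|S' /noS/negP S'G sS'] := @minor_edges_below E A B S SE.
  by rewrite disjoint_sym (disjointWr SG).
apply: S'G; apply: subset_trans sS' _; rewrite subDset.
by rewrite (subset_trans SG) ?subsetUr.
Qed.

(** * Facets of a minor around a free vertex *)

Section FreeVertex.
Variables (V : {set T}) (E : {set {set T}}) (A B : {set T}).
Variables (x : T) (e : {set T}).
Hypothesis edges_x : [set S in minor_edges E A B | x \in S] = [set e].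
Hypothesis xV : x \in V.

Local Notation face := (minor_face V E A B).

Let e_edge : e \in minor_edges E A B.
Proof. by have := set11 e; rewrite -edges_x inE => /andP[]. Qed.

Let x_e : x \in e.
Proof. by have := set11 e; rewrite -edges_x inE => /andP[]. Qed.

Let e_notA z : z \in e -> z \notin A.
Proof.
have [S [_ SA ->]] := minor_edgesP e_edge.
by rewrite inE => /andP[_ zS]; rewrite (disjointFr SA zS).
Qed.

Let e_notB z : z \in e -> z \notin B.
Proof. by have [S [_ _ ->]] := minor_edgesP e_edge; rewrite inE => /andP[]. Qed.

Let edge_x S : S \in minor_edges E A B -> x \in S -> S = e.
Proof. by move=> SD xS; apply/set1P; rewrite -edges_x inE SD. Qed.

Let face_not_e G : face G -> ~~ (e \subset G).
Proof. by rewrite minor_faceE => /and4P[_ _ _ /forall_inP]; apply. Qed.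

(** Adding [x] to a subset of a face can only complete an edge through [x], and [e] is the only
    one. *)
Let face_setU1 G H :
    face G -> H \subset G -> B \subset H -> ~~ (e \subset x |: H) ->
  face (x |: H).
Proof.
rewrite !minor_faceE => /and4P[_ AG GV /forall_inP noS] HG BH eH.
apply/and4P; split.
- by rewrite (subset_trans BH) ?subsetUr.
- by rewrite disjoint_sym disjointsU1 e_notA //= disjoint_sym (disjointWr HG).
- by rewrite subUset sub1set xV (subset_trans HG).
apply/forall_inP => S SD; have [xS|xS] := boolP (x \in S).
  by rewrite (edge_x SD xS).
apply: contra (noS S SD) => /subsetP SH; apply/subsetP => z zS.
have /setU1P[zx|] := SH z zS; first by rewrite -zx zS in xS.
exact: (subsetP HG).
Qed.

(** Otherwise [x |: G] would be a larger face, as it would not contain [e]. *)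
Lemma facet_avoiding_free_vertex G : maxset face G -> x \notin G -> e :\ x \subset G.
Proof.
move=> /maxsetP[fG maxG] xG; rewrite subDset.
apply: contraR xG => eG; rewrite -(maxG (x |: G)) ?setU11 ?subsetUr //.
by apply: (face_setU1 fG) => //; case/and3P: fG.
Qed.

Lemma maxset_face_one G :
  maxset (minor_face V E A (x |: B)) G = maxset face G && (x \in G).
Proof.
have faceE H : minor_face V E A (x |: B) H = face H && (x \in H).
  by rewrite /minor_face subUset sub1set andbC -!andbA; do !bool_congr.
apply/maxsetP/andP => [[]|[/maxsetP[fG maxG] xG]].
  rewrite faceE => /andP[fG xG] maxG; split=> //; apply/maxsetP; split=> // H fH GH.
  by apply: maxG => //; rewrite faceE fH (subsetP GH).
by split=> [|H]; rewrite faceE ?fG // => /andP[fH _]; apply: maxG.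
Qed.

(** Maximality is the same in both families: a face containing [e :\ x] cannot contain [x], or it
    would contain [e]. *)
Lemma maxset_face_zero G :
  maxset (minor_face V E (x |: A) (B :|: e :\ x)) G = maxset face G && (x \notin G).
Proof.
have faceE H : minor_face V E (x |: A) (B :|: e :\ x) H =
    [&& face H, x \notin H & e :\ x \subset H].
  by rewrite /minor_face subUset disjointsU1 -!andbA; do !bool_congr.
apply/maxsetP/andP => [[]|[mG xG]].
  rewrite faceE => /and3P[fG xG eG] maxG; split=> //; apply/maxsetP.
  split=> // H fH GH; have eH := subset_trans eG GH.
  apply: maxG => //; rewrite faceE fH eH andbT.
  apply: contra (face_not_e fH) => xH.
  by rewrite -(setD1K x_e) subUset sub1set xH.
have [fG maxG] := maxsetP mG; split=> [|H].
  by rewrite faceE fG xG facet_avoiding_free_vertex.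
by rewrite faceE => /and3P[fH _ _]; apply: maxG.
Qed.

Lemma free_vertex_exchange H G :
    maxset face H -> x \in H -> maxset face G -> x \notin G ->
  exists v L, [/\ v \in G :\: H, maxset face L && (x \in L) & G :\: L = [set v]].
Proof.
move=> /maxsetp fH xH mG xG; have eG := facet_avoiding_free_vertex mG xG.
have [y ye yH] := subsetPn (face_not_e fH).
have yx : y != x by apply: contraNneq yH => ->.
have yG : y \in G by apply: (subsetP eG); rewrite !inE yx.
have fG := maxsetp mG.
have fG' : face (x |: G :\ y).
  apply: (face_setU1 fG); first exact: subsetDl.
    by rewrite subsetD1 e_notB // andbT; case/and3P: fG.
  by apply/subsetPn; exists y; rewrite // !inE eqxx orbF.
have [L mL GL] := maxset_exists fG'; exists y, L; split.
- by rewrite inE yH.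
- by rewrite mL (subsetP GL) ?setU11.
apply/setP => z; rewrite !inE; have [->|zy] := eqVneq z y.
  (* With [y] the face [L] would contain all of [e]: the rest of [e] is [x] together with elements
     of [G :\ y]. *)
  rewrite yG andbT; apply: contra (face_not_e (maxsetp mL)) => yL.
  apply/subsetP => t te; have [->//|ty] := eqVneq t y.
  apply: (subsetP GL); rewrite !inE ty /=.
  by have [//|tx] := eqVneq t x; apply: (subsetP eG); rewrite !inE tx.
apply/negP => /andP[/negP zL zG]; apply: zL; apply: (subsetP GL).
by rewrite !inE zy zG orbT.
Qed.

End FreeVertex.

(** * Induction over all minors *)

Definition has_shelling (P : pred {set T}) : Prop :=
  exists s, [/\ uniq s, s =i maxset P & shelling_order s].

(** A free vertex is assumed only where the minor ideal is neither zero nor the whole ring; the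
    induction also reaches these two cases and treats them directly. *)
Lemma free_vertices_has_shelling V E :
    (forall S, S \in E -> S \subset V) ->
    (forall A B, A \subset V -> B \subset V -> [disjoint A & B] ->
       minor_edges E A B != set0 -> set0 \notin minor_edges E A B ->
       exists2 x, x \in V & #|[set S in minor_edges E A B | x \in S]| = 1) ->
  has_shelling (indep V E).
Proof.
move=> EV free.
suff main m A B : A \subset V -> B \subset V -> [disjoint A & B] ->
    #|V :\: (A :|: B)| < m -> has_shelling (minor_face V E A B).
  have := main _ set0 set0 (sub0set _) (sub0set _) (disjoint0s _) (ltnSn _).
  case=> s [us sE sh]; exists s; split=> // G.
  rewrite sE; apply/maxsetP/maxsetP; rewrite /minor_face sub0set disjoint0s /=.
    by move=> [fG maxG]; split=> // H fH; apply: maxG; rewrite sub0set disjoint0s.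
  by move=> [fG maxG]; split=> // H; rewrite sub0set disjoint0s; apply: maxG.
elim: m A B => // m IH A B AV BV AB; rewrite ltnS => cardm.
(* Zero ideal: the faces form an interval with the single facet [V :\: A]. *)
have [D0|D_n0] := eqVneq (minor_edges E A B) set0.
  have faceE G : minor_face V E A B G = (B \subset G) && (G \subset V :\: A).
    rewrite minor_faceE D0 subsetD [[disjoint G & A]]disjoint_sym.
    have -> : [forall S in (set0 : {set {set T}}), ~~ (S \subset G)] by apply/forall_inP => S; rewrite inE.
    by rewrite andbT [in RHS]andbC -andbA andbC -!andbA; do !bool_congr.
  exists [:: V :\: A]; split=> // [G|[|i] [|j]]; rewrite ?andbF //.
  rewrite inE; apply/eqP/maxsetP => [->|[]].
    rewrite faceE subxx subsetD BV disjoint_sym AB; split=> // H.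
    by rewrite faceE => /andP[_ HV] VH; apply/eqP; rewrite eqEsubset HV.
  rewrite faceE => /andP[BG GV] maxG; apply/esym/maxG => //.
  by rewrite faceE subxx (subset_trans BG GV).
(* Unit ideal: there is no face at all, so the empty list is a shelling. *)
have [D0|D_0] := boolP (set0 \in minor_edges E A B).
  exists [::]; split=> // [G|i j]; last by rewrite andbF.
  rewrite in_nil; apply/esym/negP => /maxsetp.
  by rewrite minor_faceE => /and4P[_ _ _ /forall_inP/(_ _ D0)]; rewrite sub0set.
have [x xV /eqP/cards1P[e ex]] := free A B AV BV AB D_n0 D_0.
have /andP[eD xe] : (e \in minor_edges E A B) && (x \in e).
  by have := set11 e; rewrite -ex inE.
have [S [SE SA eE]] := minor_edgesP eD.
have eV : e \subset V by rewrite eE (subset_trans (subsetDl _ _)) ?EV.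
have eA : [disjoint e & A] by rewrite eE (disjointWl (subsetDl _ _)).
have eB : [disjoint e & B] by rewrite eE disjoint_sym disjoints_subset subsetC subsetDr.
have xA : x \notin A by rewrite (disjointFr eA xe).
have xB : x \notin B by rewrite (disjointFr eB xe).
(* Both recursive calls fix the value of [x], which was still a remaining vertex, so the measure
   drops. *)
have smaller A' B' : A \subset A' -> B \subset B' -> x \in A' :|: B' ->
    #|V :\: (A' :|: B')| < m.
  move=> AA' BB' xAB; apply: leq_trans cardm; apply: proper_card.
  apply/properP; split; first by rewrite setDS ?setUSS.
  by exists x; rewrite in_setD ?xAB // xV inE (negPf xA) (negPf xB).
have [||||s1 [us1 s1E sh1]] := IH A (x |: B) => //.
- by rewrite subUset sub1set xV.
- by rewrite disjoint_sym disjointsU1 xA disjoint_sym.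
- by apply: smaller; rewrite ?subsetUr // !inE eqxx orbT.
have [||||s2 [us2 s2E sh2]] := IH (x |: A) (B :|: e :\ x).
- by rewrite subUset sub1set xV.
- by rewrite subUset BV (subset_trans (subsetDl _ _)).
- rewrite disjointsU1 !inE negb_or xB eqxx /= disjoint_sym disjointsU.
  by rewrite disjoint_sym AB (disjointWl (subsetDl _ _)).
- by apply: smaller; rewrite ?subsetUr ?subsetUl // !inE eqxx.
have s1P G : (G \in s1) = maxset (minor_face V E A B) G && (x \in G).
  by rewrite s1E -(maxset_face_one V E).
have s2P G : (G \in s2) = maxset (minor_face V E A B) G && (x \notin G).
  by rewrite s2E -(maxset_face_zero ex xV).
exists (s1 ++ s2); split.
- rewrite cat_uniq us1 us2 andbT /=; apply/hasPn => G.
  by rewrite s1P s2P => /andP[_ /negPf->]; rewrite andbF.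
- by move=> G; rewrite mem_cat s1P s2P -andb_orr orbN andbT.
apply: shelling_order_cat => // H G; rewrite s1P s2P => /andP[mH xH] /andP[mG xG].
have [v [L [vGH mL GL]]] := free_vertex_exchange ex xV mH xH mG xG.
by exists v, L; rewrite s1P.
Qed.

End Shellings.

(** * Squarefree monomial ideals *)

Section MonomialIdeals.
Variables (k : fieldType) (n : nat).
Implicit Types (V A B F S : {set 'I_n}) (E : {set {set 'I_n}}).
Implicit Types (p q : {mpoly k[n]}) (g : {set 'I_n} -> {mpoly k[n]}).

Local Open Scope ring_scope.

Lemma in_subring0 V : in_subring V (0 : {mpoly k[n]}).
Proof. by move=> m; rewrite msupp0. Qed.

Lemma in_subring1 V : in_subring V (1 : {mpoly k[n]}).
Proof. by move=> m; rewrite msupp1 inE => /eqP-> i _; rewrite mnm0E. Qed.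

Lemma in_subringD V p q : in_subring V p -> in_subring V q -> in_subring V (p + q).
Proof.
move=> hp hq m /msuppD_le; rewrite mem_cat => /orP[mp|mq]; first exact: hp.
exact: hq.
Qed.

Lemma ideal_gen0 V E g : ideal_gen V E g 0.
Proof.
exists (fun=> 0) => [S _|]; first exact: in_subring0.
by rewrite big1 // => S _; rewrite mul0r.
Qed.

Lemma ideal_gen_sum V E g (I : finType) (P : pred I) (f : I -> {mpoly k[n]}) :
    (forall i, P i -> ideal_gen V E g (f i)) ->
  ideal_gen V E g (\sum_(i | P i) f i).
Proof.
move=> gf; elim/big_ind: _ => // [|p q [c cV ->] [d dV ->]].
  exact: ideal_gen0.
exists (fun S => c S + d S) => [S SE|].
  by apply: in_subringD; [apply: cV|apply: dV].
by rewrite -big_split; apply: eq_bigr => S _; rewrite mulrDl.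
Qed.

Lemma ideal_genM V E g p q :
  in_subring V p -> ideal_gen V E g q -> ideal_gen V E g (p * q).
Proof.
move=> pV [c cV ->]; exists (fun S => p * c S) => [S SE|].
  by apply: in_subringM => //; apply: cV.
by rewrite mulr_sumr; apply: eq_bigr => S _; rewrite mulrA.
Qed.

Lemma ideal_gen_generator V E g S : S \in E -> ideal_gen V E g (g S).
Proof.
move=> SE; exists (fun S' => if S' == S then 1 else 0) => [S' _|].
  by case: ifP => _; [apply: in_subring1|apply: in_subring0].
rewrite (bigD1 S) //= eqxx mul1r big1 ?addr0 // => S' /andP[_ /negPf->].
by rewrite mul0r.
Qed.

Lemma ideal_gen_sub V E E' g g' p :
    (forall S, S \in E -> ideal_gen V E' g' (g S)) ->
  ideal_gen V E g p -> ideal_gen V E' g' p.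
Proof.
move=> gE' [c cV ->]; apply: ideal_gen_sum => S SE.
by apply: ideal_genM; [apply: cV|apply: gE'].
Qed.

Lemma ideal_gen_xprod V E S F :
  F \subset V -> S \in E -> S \subset F -> ideal_gen V E (@xprod k n) (xprod k F).
Proof.
move=> FV SE SF; have -> : xprod k F = xprod k (F :\: S) * xprod k S.
  by rewrite mulrC /xprod (big_setID S) /= (setIidPr SF).
apply: ideal_genM; last exact: ideal_gen_generator.
by apply: in_subring_xprod; apply: subset_trans FV; apply: subsetDl.
Qed.

(** Evaluation at the indicator point of [F] turns divisibility of squarefree monomials into a 0/1
    value. *)
Lemma meval_xprod F S :
  (xprod k S).@[fun i => (i \in F)%:R] = (S \subset F)%:R.
Proof.
rewrite /xprod rmorph_prod /=; under eq_bigr do rewrite mevalXU.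
have [/subsetP SF|/subsetPn[i iS iF]] := boolP (S \subset F).
  by apply: big1 => i /SF ->.
by rewrite (bigD1 i) //= (negPf iF) mul0r.
Qed.

(** At the indicator point of [F] the monomial is 1, so some generator must not vanish there,
    whatever the coefficients. *)
Lemma ideal_gen_xprodP V E F :
    ideal_gen V E (@xprod k n) (xprod k F) ->
  exists2 S, S \in E & S \subset F.
Proof.
move=> [c _ /(congr1 (meval (fun i => (i \in F)%:R)))].
rewrite meval_xprod subxx rmorph_sum /= => eF; apply/exists_inP.
apply: contraT => /exists_inPn noS; case/eqP: (oner_neq0 k).
rewrite [LHS]eF big1 // => S /noS/negPf SF.
by rewrite rmorphM /= meval_xprod SF mulr0.
Qed.

Lemma xprod_neq0 S : xprod k S != 0.
Proof.
have := meval_xprod S S; rewrite subxx.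
by apply: contra_eq_neq => ->; rewrite meval0 eq_sym oner_neq0.
Qed.

Lemma subst01_xprod A B S :
  subst01 A B (xprod k S) = if [disjoint S & A] then xprod k (S :\: B) else 0.
Proof.
rewrite /subst01 /xprod rmorph_prod /=.
under eq_bigr do rewrite comp_mpolyXU -tnth_nth tnth_mktuple.
case: ifPn => [SA|/pred0Pn[i /andP[/= iS iA]]]; last by rewrite (bigD1 i) //= iA mul0r.
rewrite (big_setID B) /= big1 ?mul1r => [|i].
  by apply: eq_bigr => i /setDP[iS /negPf->]; rewrite (disjointFr SA iS).
by case/setIP=> iS ->; rewrite (disjointFr SA iS).
Qed.

End MonomialIdeals.

(** * From combinatorial minors to algebraic minors *)

Section MinorClutter.
Variables (k : fieldType) (n : nat) (C : clutter n) (A B : {set 'I_n}).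

Local Notation D := (minor_edges (edges C) A B).
Local Notation V := (vertices C :\: (A :|: B)).

Lemma minor_edges_sub S : S \in D -> S \subset V.
Proof.
case/minor_edgesP=> S' [S'E S'A ->]; rewrite setDUr subsetI setSD ?edges_sub // andbT.
by rewrite (subset_trans (subsetDl _ _)) // subsetD edges_sub.
Qed.

Definition minor_clutter : clutter n :=
  Clutter minor_edges_sub (@minor_edges_antichain _ (edges C) A B).

(** Edges meeting [A] become 0, and every other substituted generator is a multiple of one with
    minimal support. *)
Lemma minor_idealE : eq_ideal (ideal_gen V D (@xprod k n)) (minor_ideal C A B).
Proof.
move=> p; split; apply: ideal_gen_sub => S.
  case/minor_edgesP=> S' [S'E S'A ->].
  have := ideal_gen_generator V (fun S => subst01 A B (xprod k S)) S'E.
  by rewrite /= subst01_xprod S'A.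
move=> SE; rewrite subst01_xprod; case: ifP => [SA|_].
  have [S' S'D S'S] := minor_edges_below B SE SA.
  apply: ideal_gen_xprod S'D S'S.
  rewrite setDUr subsetI setSD ?edges_sub // andbT.
  by rewrite (subset_trans (subsetDl _ _)) // subsetD edges_sub.
exact: ideal_gen0.
Qed.

Lemma minor_clutterP :
    A \subset vertices C -> B \subset vertices C -> [disjoint A & B] ->
    D != set0 -> set0 \notin D ->
  is_minor k C minor_clutter.
Proof.
move=> AV BV AB /set0Pn[S SD] D0; right; exists A, B; split=> //; split=> //.
  split; first exists (xprod k S).
  - exact/minor_idealE/ideal_gen_generator.
  - exact/eqP/xprod_neq0.
  exists (xprod k set0); first exact/in_subring_xprod/sub0set.
  move=> /minor_idealE/ideal_gen_xprodP[S' S'D].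
  by rewrite subset0 => /eqP S'0; rewrite S'0 (negPf D0) in S'D.
split=> [|E' /properP[sE' [S' S'D S'E']] eqI]; first exact: minor_idealE.
(* If a smaller family [E'] sufficed, the omitted edge [S'] would contain an edge of [E'], against
   the antichain property. *)
have /minor_idealE/eqI/ideal_gen_xprodP[S'' S''E' S''S'] :=
  ideal_gen_generator V (@xprod k n) S'D.
have S''D := subsetP sE' _ S''E'.
by rewrite (minor_edges_antichain S''D S'D S''S') (negPf S'E') in S''E'.
Qed.

End MinorClutter.

(** * Shellability of the Stanley-Reisner complex *)

Lemma sr_faceP (k : fieldType) (n : nat) (C : clutter n) (F : {set 'I_n}) :
  reflect (sr_face k C F) (indep (vertices C) (edges C) F).
Proof.
apply: (iffP andP) => -[FV noS]; split=> //.
  by move=> /ideal_gen_xprodP[S SE SF]; move/forall_inP/(_ S SE)/negP: noS.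
by apply/forall_inP => S SE; apply/negP => SF; apply: noS; apply: ideal_gen_xprod SE SF.
Qed.

Theorem theorem5p3 (k : fieldType) (n : nat) (C : clutter n)
    (hX : vertices C = [set: 'I_n])
    (hC : free_vertex_property k C) :
  shellable (stanley_reisner k C).
Proof.
have [||s [us sE sh]] := @free_vertices_has_shelling _ (vertices C) (edges C).
- exact: edges_sub.
- move=> A B AV BV AB Dn0 D0.
  (* The two conditions on the minimal edges make the minor ideal nonzero and proper, so the free
     vertex property applies. *)
  have [x [/setDP[xV _] x1]] := hC _ (minor_clutterP k AV BV AB Dn0 D0).
  by exists x.
exists s; split=> // F; rewrite sE.
split=> [/maxsetP[/(sr_faceP k) fF maxF]|[/sr_faceP fF maxF]].
  by split=> // G /sr_faceP; apply: maxF.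
by apply/maxsetP; split=> // G /(sr_faceP k); apply: maxF.
Qed.
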